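(* Let $\mathbb{F}$ be a field with involution $\overline{\,\cdot\,}$, let $m,n\ge 1$, let $x,y\in\mathbb{F}^m$ and $z,w\in\mathbb{F}^n$ be column vectors with all entries nonzero, let $a,b\in\mathbb{F}\setminus\{0\}$, and let $$M=\left[\begin{array}{cc|cc}0&x^T&a&0\\ y&0&0&0\\ \hline b&0&0&z^T\\ 0&0&w&0\end{array}\right]$$ (a square matrix of order $m+n+2$). Assume $x^Ty=z^Tw=0$. Then: (1) $M$ is core EP invertible if and only if $r:=a\overline{a}+w^*w\neq 0$ and $h:=b\overline{b}+y^*y\neq 0$. In this case, $$M^{\mathrm{cEP}}=\left[\begin{array}{cc|cc}0&h^{-1}y^*&\overline{b}h^{-1}&0\\ \overline{a}(br)^{-1}y&0&0&(br)^{-1}yw^*\\ \hline \overline{a}r^{-1}&0&0&r^{-1}w^*\\ 0&(ah)^{-1}wy^*&\overline{b}(ah)^{-1}w&0\end{array}\right].$$ (2) $M$ is dual core EP invertible if and only if $p:=b\overline{b}+z^*z\neq 0$ and $q:=a\overline{a}+x^*x\neq 0$. In this case, $$M_{\mathrm{cEP}}=\left[\begin{array}{cc|cc}0&\overline{b}(ap)^{-1}x^T&\overline{b}p^{-1}&0\\ q^{-1}\overline{x}&0&0&(bq)^{-1}\overline{x}z^T\\ \hline \overline{a}q^{-1}&0&0&\overline{a}(bq)^{-1}z^T\\ 0&(ap)^{-1}\overline{z}x^T&p^{-1}\overline{z}&0\end{array}\right].$$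
   Context: For a matrix $A=[a_{ij}]$ over a field $\mathbb{F}$ with involution $\overline{\,\cdot\,}$ (a field automorphism with $\overline{\overline{c}}=c$), $\overline{A}=[\overline{a_{ij}}]$ and $A^*=\overline{A}^{\,T}$. All $4\times4$ block matrices have rows and columns partitioned with sizes $1,m,1,n$; each $0$ is a zero block of the appropriate size. Matrices $M$ of the displayed form (with $a,b$ and all entries of $x,y,z,w$ nonzero) are the matrices whose associated digraph is a double star digraph, in canonical form. A square matrix $A$ is core EP invertible if there is a matrix $X$ with $XA^{k+1}=A^k$ for some nonnegative integer $k$, $AX^2=X$, and $(AX)^*=AX$; such $X$ is unique and is called the core EP inverse, denoted $A^{\mathrm{cEP}}$. Dually, $A$ is dual core EP invertible if there is a matrix $X$ with $A^{k+1}X=A^k$ for some nonnegative integer $k$, $X^2A=X$, and $(XA)^*=XA$; such $X$ is unique and is called the dual core EP inverse, denoted $A_{\mathrm{cEP}}$. *)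

(* Defs.v *)
From HB Require Import structures.
From mathcomp Require Import all_boot all_order all_algebra.

Set Implicit Arguments.
Unset Strict Implicit.
Unset Printing Implicit Defensive.

Import GRing.Theory.

Local Open Scope ring_scope.

Definition adjmx (F : fieldType) (conj : involutive_rmorphism F) (m n : nat)
    (A : 'M[F]_(m, n)) : 'M[F]_(n, m) :=
  (map_mx conj A)^T.

Definition is_core_EP_inverse (F : fieldType) (conj : involutive_rmorphism F)
    (n : nat) (A X : 'M[F]_n) : Prop :=
  [/\ exists k : nat, X *m A ^+ k.+1 = A ^+ k,
      A *m X ^+ 2 = X
    & adjmx conj (A *m X) = A *m X].

Definition core_EP_invertible (F : fieldType) (conj : involutive_rmorphism F)
    (n : nat) (A : 'M[F]_n) : Prop :=
  exists X : 'M[F]_n, is_core_EP_inverse conj A X.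

Definition is_dual_core_EP_inverse (F : fieldType)
    (conj : involutive_rmorphism F) (n : nat) (A X : 'M[F]_n) : Prop :=
  [/\ exists k : nat, A ^+ k.+1 *m X = A ^+ k,
      X ^+ 2 *m A = X
    & adjmx conj (X *m A) = X *m A].

Definition dual_core_EP_invertible (F : fieldType)
    (conj : involutive_rmorphism F) (n : nat) (A : 'M[F]_n) : Prop :=
  exists X : 'M[F]_n, is_dual_core_EP_inverse conj A X.

Definition double_star_mx (F : fieldType) (m n : nat) (x y : 'cV[F]_m)
    (z w : 'cV[F]_n) (a b : F) : 'M[F]_((1 + m) + (1 + n)) :=
  block_mx (block_mx 0 x^T y 0)   (block_mx a%:M 0 0 0)
           (block_mx b%:M 0 0 0)  (block_mx 0 z^T w 0).

(* The two inverses are unique, so the relations above determine the matrices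
   written A^cEP and A_cEP. *)

Section Uniqueness.

Variables (F : fieldType) (conj : involutive_rmorphism F).

Lemma adjmxM m n p (A : 'M[F]_(m, n)) (B : 'M[F]_(n, p)) :
  adjmx conj (A *m B) = adjmx conj B *m adjmx conj A.
Proof. by rewrite /adjmx map_mxM trmx_mul. Qed.

Lemma adjmxK m n : cancel (@adjmx F conj m n) (@adjmx F conj n m).
Proof. by move=> A; apply/matrixP=> i j; rewrite !mxE rmorphK. Qed.

Lemma adjmxX n (A : 'M[F]_n) k : adjmx conj (A ^+ k) = adjmx conj A ^+ k.
Proof.
elim: k => [|k IHk]; first by rewrite /adjmx !expr0 map_mx1 trmx1.
by rewrite exprS adjmxM IHk exprSr.
Qed.

Lemma core_EP_inverse_uniq n (A X Y : 'M[F]_n) :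
  is_core_EP_inverse conj A X -> is_core_EP_inverse conj A Y -> X = Y.
Proof.
have powE (Z : 'M[F]_n) : A * Z ^+ 2 = Z -> forall k, Z = A ^+ k * Z ^+ k.+1.
  move=> AZ; elim=> [|k IHk]; first by rewrite mul1r.
  have -> : A ^+ k.+1 * Z ^+ k.+2 = A ^+ k * (A * Z ^+ 2 * Z ^+ k).
    by rewrite exprSr -(mulrA _ A) -(mulrA A) -(exprD Z 2 k).
  by rewrite AZ -exprS.
have upE (Z : 'M[F]_n) k j : Z * A ^+ k.+1 = A ^+ k ->
    Z * A ^+ (k + j).+1 = A ^+ (k + j).
  by move=> ZA; rewrite -addSn exprD mulrA ZA -exprD.
move=> [[k1 X1] X2 X3] [[k2 Y1] Y2 Y3].
set k := (k1 + k2)%N.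
have {}X1 : X * A ^+ k.+1 = A ^+ k by exact: upE.
have {}Y1 : Y * A ^+ k.+1 = A ^+ k by rewrite /k addnC; exact: upE.
have abs (U V : 'M[F]_n) : U * A ^+ k.+1 = A ^+ k -> A * V ^+ 2 = V ->
    U * (A * V) = V.
  move=> UA AV; rewrite {1}(powE V AV k) 2!mulrA.
  by rewrite -(mulrA U) -exprS UA -(powE V AV k).
have XY := abs _ _ X1 Y2; have YX := abs _ _ Y1 X2.
have PQ : A *m X = A *m Y.
  have QP : (A *m Y) *m (A *m X) = A *m X.
    by rewrite -mulmxA; exact: (congr1 (mulmx A) YX).
  have PQ : (A *m X) *m (A *m Y) = A *m Y.
    by rewrite -mulmxA; exact: (congr1 (mulmx A) XY).
  by rewrite -[LHS]X3 -QP adjmxM X3 Y3 PQ.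
have XX := abs _ _ X1 X2.
exact: etrans (esym XX) (etrans (congr1 (mulmx X) PQ) XY).
Qed.

Lemma dual_core_EP_inverse_adj n (A X : 'M[F]_n) :
  is_dual_core_EP_inverse conj A X ->
  is_core_EP_inverse conj (adjmx conj A) (adjmx conj X).
Proof.
move=> [[k X1] X2 X3]; split.
- by exists k; rewrite -!adjmxX -adjmxM X1.
- by rewrite -adjmxX -adjmxM X2.
- by rewrite -adjmxM X3.
Qed.

Lemma dual_core_EP_inverse_uniq n (A X Y : 'M[F]_n) :
  is_dual_core_EP_inverse conj A X -> is_dual_core_EP_inverse conj A Y ->
  X = Y.
Proof.
move=> /dual_core_EP_inverse_adj AX /dual_core_EP_inverse_adj AY.
exact: (can_inj (@adjmxK n n)) (core_EP_inverse_uniq AX AY).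
Qed.

End Uniqueness.

(* Main.v *)
Require Import Defs.
From mathcomp Require Import all_boot all_order all_algebra.

(** Index the four blocks by u (the first center), the leaves of u, v (the
    second center) and the leaves of v.  Put
      c1 = M e_u = (0, y, b, 0)^T,   c2 = M e_v = (a, 0, 0, w)^T.
    As x^T y = z^T w = 0, M swaps the two lines that they span, M c1 = b c2
    and M c2 = a c1, and M ^+ 2 = c1 d1 + c2 d2, where d1 and d2 are the rows
    of M at u and at v.  Hence M acts bijectively on U = span(c1, c2), which is
    the range of every M ^+ k with k >= 2.

    For a core EP inverse X, the matrix M X is a self-adjoint idempotent with
    range U, that is, an orthogonal projector onto U; such a projector exists
    only if the Hermitian form is nondegenerate on U.  The vectors c1 and c2
    are orthogonal, with c1^* c1 = h and c2^* c2 = r, so this means that h and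
    r are nonzero ([core_EP_eigenvector_not_orthogonal]).  Conversely, inverting
    M on U after projecting onto U gives
      X = (a h)^-1 c2 c1^* + (b r)^-1 c1 c2^*,
    and it satisfies the core EP equations ([swap_core_EP_inverse]).

    Part (2) is part (1) for M^*, which is again a double star matrix, with
    (x, y, z, w, a, b) replaced by the conjugates of (y, x, w, z, b, a), so
    that (r, h) becomes (p, q). *)

Set Implicit Arguments.
Unset Strict Implicit.

Local Open Scope ring_scope.

Import GRing.Theory.

(** * Adjoints *)

Lemma invfMK (F : fieldType) (u v : F) : u != 0 -> (u * v)^-1 * u = v^-1.
Proof. by move=> u0; rewrite mulrC invfM mulVKf. Qed.

Section Adjoint.

Variables (F : fieldType) (conj : involutive_rmorphism F).

Local Notation "A ^h" := (adjmx conj A) (at level 2, format "A ^h").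

Lemma conjV (c : F) : conj c^-1 = (conj c)^-1.
Proof. exact: fmorphV. Qed.

Lemma conjD (c d : F) : conj (c + d) = conj c + conj d.
Proof. exact: rmorphD. Qed.

Lemma conjM (c d : F) : conj (c * d) = conj c * conj d.
Proof. exact: rmorphM. Qed.

Lemma adjmx0 m n : (0 : 'M[F]_(m, n))^h = 0.
Proof. by rewrite /adjmx map_mx0 trmx0. Qed.

Lemma adjmxD m n (A B : 'M[F]_(m, n)) : (A + B)^h = A^h + B^h.
Proof. by rewrite /adjmx map_mxD linearD. Qed.

Lemma adjmxZ m n c (A : 'M[F]_(m, n)) : (c *: A)^h = conj c *: A^h.
Proof. by rewrite /adjmx map_mxZ linearZ. Qed.

Lemma adjmx_scalar n c : (c%:M : 'M[F]_n)^h = (conj c)%:M.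
Proof. by rewrite /adjmx map_scalar_mx tr_scalar_mx. Qed.

Lemma adjmx_col m1 m2 n (A : 'M[F]_(m1, n)) (B : 'M[F]_(m2, n)) :
  (col_mx A B)^h = row_mx A^h B^h.
Proof. by rewrite /adjmx map_col_mx tr_col_mx. Qed.

Lemma adjmx_block m1 m2 n1 n2 (A : 'M[F]_(m1, n1)) (B : 'M[F]_(m1, n2))
    (C : 'M[F]_(m2, n1)) (D : 'M[F]_(m2, n2)) :
  (block_mx A B C D)^h = block_mx A^h C^h B^h D^h.
Proof. by rewrite /adjmx map_block_mx tr_block_mx. Qed.

Lemma adjmx_map m n (A : 'M[F]_(m, n)) : (map_mx conj A)^h = A^T.
Proof. by apply/matrixP=> i j; rewrite !mxE rmorphK. Qed.

Lemma adjmx_tr m n (A : 'M[F]_(m, n)) : (A^T)^h = map_mx conj A.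
Proof. by rewrite /adjmx map_trmx trmxK. Qed.

Definition sqnorm n (v : 'cV[F]_n) : F := (v^h *m v) 0 0.

Lemma sqnormE n (v : 'cV[F]_n) : v^h *m v = (sqnorm v)%:M.
Proof. exact: mx11_scalar. Qed.

Lemma conj_sqnorm n (v : 'cV[F]_n) : conj (sqnorm v) = sqnorm v.
Proof.
have: (v^h *m v)^h = v^h *m v by rewrite adjmxM adjmxK.
rewrite sqnormE adjmx_scalar => /(congr1 (fun A : 'M_1 => A 0 0)).
by rewrite !mxE.
Qed.

Lemma conj_norm_add_sqnorm n c (v : 'cV[F]_n) :
  conj (c * conj c + sqnorm v) = c * conj c + sqnorm v.
Proof. by rewrite conjD conjM rmorphK conj_sqnorm mulrC. Qed.

Lemma sqnorm_map_conj n (v : 'cV[F]_n) : sqnorm (map_mx conj v) = sqnorm v.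
Proof.
rewrite /sqnorm adjmx_map -[LHS]mulr1n !mxE mulr1n.
by apply: eq_bigr => i _; rewrite !mxE mulrC.
Qed.

Lemma core_EP_inverse_adj n (A X : 'M[F]_n) :
  is_core_EP_inverse conj A X -> is_dual_core_EP_inverse conj A^h X^h.
Proof.
move=> [[k X1] X2 X3]; split.
- by exists k; rewrite -!adjmxX -adjmxM X1.
- by rewrite -adjmxX -adjmxM X2.
- by rewrite -adjmxM X3.
Qed.

Lemma dual_core_EP_invertible_adj n (A : 'M[F]_n) :
  dual_core_EP_invertible conj A <-> core_EP_invertible conj A^h.
Proof.
split=> [[X AX]|[X AX]]; first by exists X^h; exact: dual_core_EP_inverse_adj.
by exists X^h; rewrite -(adjmxK conj A); exact: core_EP_inverse_adj.
Qed.

(** * Core EP inverses of matrices that swap two lines *)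

(** A core EP inverse X makes P = A X self-adjoint; P fixes c, which lies in the
    range of every power of A.  The range of P = A ^+ j X ^+ j lies in that
    of A ^+ j, so if c is orthogonal to the latter then c^* P = 0, and
    taking adjoints, P c = 0. *)
Lemma core_EP_eigenvector_not_orthogonal n (A : 'M[F]_n) (c : 'cV[F]_n) s j :
    core_EP_invertible conj A -> c != 0 -> s != 0 ->
    A ^+ j.+1 *m c = s *: c ->
  c^h *m A ^+ j.+1 != 0.
Proof.
move=> [X [[k XA] AXX AXh]] c0 s0 Ac; apply: contra_neq c0 => cA.
have AX i : A *m X = A ^+ i.+1 *m X ^+ i.+1.
  elim: i => [//|i ->].
  have AXX2 : A * X ^+ 2 = X := AXX.
  have {1}-> : X ^+ i.+1 = A * X ^+ i.+2
    by rewrite (exprD X 2 i) mulrA AXX2 -exprS.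
  by rewrite !mulmxE mulrA -exprSr.
have Pc0 : A *m X *m c = 0.
  by rewrite -[A *m X]AXh -[c](adjmxK conj) -adjmxM (AX j) mulmxA cA
             mul0mx adjmx0.
(* c lies in the range of every power of A, hence is fixed by P *)
have powc i : A ^+ (j.+1 * i) *m c = s ^+ i *: c.
  elim: i => [|i IHi]; first by rewrite muln0 !expr0 mul1mx scale1r.
  by rewrite mulnS exprD -mulmxA IHi -scalemxAr Ac scalerA exprSr.
have Apow i : A *m X *m A ^+ (k.+1 + i) = A ^+ (k.+1 + i).
  by rewrite exprD !mulmxA -(mulmxA A) XA -mulmxE -mulmxA mulmxE mulrA -exprS.
have le : (k.+1 <= j.+1 * k.+1)%N by rewrite leq_pmull.
have /eqP := congr1 (mulmx^~ c) (Apow (j.+1 * k.+1 - k.+1)%N).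
rewrite /= (subnKC le) -mulmxA powc -scalemxAr Pc0 scaler0 eq_sym scaler_eq0.
by rewrite expf_eq0 (negPf s0) andbF => /eqP.
Qed.

Section Swap.

Variables (n : nat) (A : 'M[F]_n) (c1 c2 : 'cV[F]_n) (d1 d2 : 'rV[F]_n).
Variables (a b : F).
Hypotheses (a0 : a != 0) (b0 : b != 0).
Hypotheses (Ac1 : A *m c1 = b *: c2) (Ac2 : A *m c2 = a *: c1).
Hypothesis A2 : A ^+ 2 = c1 *m d1 + c2 *m d2.
Hypotheses (c12 : c1^h *m c2 = 0).

Lemma swap_orthogonal_sym : c2^h *m c1 = 0.
Proof. by rewrite -[c1](adjmxK conj) -adjmxM c12 adjmx0. Qed.

(** Both c1 and c2 are eigenvectors of A ^+ 2 for a b, and the range of A ^+ 2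
    lies in span(c1, c2); as c1 and c2 are orthogonal, a vanishing norm would
    make one of them orthogonal to all of that range. *)
Lemma swap_core_EP_invertible_sqnorm : c1 != 0 -> c2 != 0 ->
  core_EP_invertible conj A -> sqnorm c2 != 0 /\ sqnorm c1 != 0.
Proof.
move=> c10 c20 Ainv; have ab0 : a * b != 0 by rewrite mulf_neq0.
have A2c1 : A ^+ 2 *m c1 = (a * b) *: c1.
  by rewrite expr2 -mulmxA Ac1 -scalemxAr Ac2 scalerA mulrC.
have A2c2 : A ^+ 2 *m c2 = (a * b) *: c2.
  by rewrite expr2 -mulmxA Ac2 -scalemxAr Ac1 scalerA.
split.
- have := core_EP_eigenvector_not_orthogonal Ainv c20 ab0 A2c2.
  apply: contra_neq => c2n; rewrite A2 mulmxDr !mulmxA swap_orthogonal_sym.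
  by rewrite sqnormE c2n raddf0 !mul0mx addr0.
- have := core_EP_eigenvector_not_orthogonal Ainv c10 ab0 A2c1.
  apply: contra_neq => c1n; rewrite A2 mulmxDr !mulmxA c12.
  by rewrite sqnormE c1n raddf0 !mul0mx addr0.
Qed.

(** X projects orthogonally onto span(c1, c2), then inverts A there: it sends c1
    to a^-1 c2 and c2 to b^-1 c1.  Thus A X is the orthogonal projector, and
    X A is the identity on the range of A ^+ 2. *)
Lemma swap_core_EP_inverse : sqnorm c2 != 0 -> sqnorm c1 != 0 ->
  is_core_EP_inverse conj A
    ((a * sqnorm c1)^-1 *: (c2 *m c1^h) + (b * sqnorm c2)^-1 *: (c1 *m c2^h)).
Proof.
move=> r0 h0; set X := _ + _.
have Xc1 : X *m c1 = a^-1 *: c2.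
  rewrite mulmxDl -!scalemxAl -!mulmxA swap_orthogonal_sym sqnormE mulmx0.
  by rewrite scaler0 addr0 mul_mx_scalar scalerA invfM mulfVK.
have Xc2 : X *m c2 = b^-1 *: c1.
  rewrite mulmxDl -!scalemxAl -!mulmxA c12 sqnormE mulmx0.
  by rewrite scaler0 add0r mul_mx_scalar scalerA invfM mulfVK.
have AX : A *m X = (sqnorm c1)^-1 *: (c1 *m c1^h)
                   + (sqnorm c2)^-1 *: (c2 *m c2^h).
  rewrite mulmxDr -!scalemxAr !mulmxA Ac1 Ac2 -!scalemxAl !scalerA.
  by rewrite !invfMK.
split.
- exists 2; rewrite exprS A2 -mulmxE !mulmxDr !mulmxA.
  rewrite -!(mulmxA X A) Ac1 Ac2 -!scalemxAr Xc1 Xc2 -!scalemxAl.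
  by rewrite !scalerA !mulfV // !scale1r.
- have c1X : c1^h *m X = (sqnorm c1 / (b * sqnorm c2)) *: c2^h.
    rewrite mulmxDr -!scalemxAr !mulmxA c12 sqnormE mul0mx scaler0 add0r.
    by rewrite mul_scalar_mx scalerA mulrC.
  have c2X : c2^h *m X = (sqnorm c2 / (a * sqnorm c1)) *: c1^h.
    rewrite mulmxDr -!scalemxAr !mulmxA swap_orthogonal_sym sqnormE mul0mx.
    by rewrite scaler0 addr0 mul_scalar_mx scalerA mulrC.
  rewrite expr2 -mulmxE mulmxA AX mulmxDl -!scalemxAl -!mulmxA c1X c2X.
  by rewrite -!scalemxAr !scalerA !mulKf // addrC.
- rewrite AX adjmxD !adjmxZ !adjmxM !adjmxK.
  by rewrite !conjV !conj_sqnorm.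
Qed.

End Swap.

(** * Double star matrices *)

Section DoubleStar.

Variables (m n : nat) (x y : 'cV[F]_m) (z w : 'cV[F]_n) (a b : F).

Local Notation M := (double_star_mx x y z w a b).

Definition left_center_col : 'cV[F]_((1 + m) + (1 + n)) :=
  col_mx (col_mx 0 y) (col_mx b%:M 0).

Definition right_center_col : 'cV[F]_((1 + m) + (1 + n)) :=
  col_mx (col_mx a%:M 0) (col_mx 0 w).

Definition left_center_row : 'rV[F]_((1 + m) + (1 + n)) :=
  row_mx (row_mx 0 x^T) (row_mx a%:M 0).

Definition right_center_row : 'rV[F]_((1 + m) + (1 + n)) :=
  row_mx (row_mx b%:M 0) (row_mx 0 z^T).

Local Notation c1 := left_center_col.
Local Notation c2 := right_center_col.

Lemma mul_double_star_left_center : x^T *m y = 0 -> M *m c1 = b *: c2.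
Proof.
move=> xy; rewrite /double_star_mx !mul_block_col xy.
rewrite !mul0mx !mulmx0 !addr0 !add_col_mx !add0r !scale_col_mx !scaler0.
by rewrite !mul_mx_scalar scale_scalar_mx.
Qed.

Lemma mul_double_star_right_center : z^T *m w = 0 -> M *m c2 = a *: c1.
Proof.
move=> zw; rewrite /double_star_mx !mul_block_col zw.
rewrite !mul0mx !mulmx0 !addr0 !add_col_mx !add0r !addr0 !scale_col_mx !scaler0.
by rewrite !mul_mx_scalar scale_scalar_mx.
Qed.

Lemma double_star_mx_sqr : x^T *m y = 0 -> z^T *m w = 0 ->
  M ^+ 2 = c1 *m left_center_row + c2 *m right_center_row.
Proof.
move=> xy zw; rewrite expr2 -mulmxE /double_star_mx !mulmx_block.
rewrite /left_center_col /right_center_col /left_center_row /right_center_row.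
rewrite xy zw !mul_col_row !add_block_mx.
by rewrite ?(mul0mx, mulmx0, addr0, add0r).
Qed.

Lemma center_cols_orthogonal : c1^h *m c2 = 0.
Proof.
by rewrite !adjmx_col !mul_row_col !adjmx0 !mulmx0 !mul0mx !addr0.
Qed.

Lemma sqnorm_left_center_col : sqnorm c1 = b * conj b + sqnorm y.
Proof.
rewrite /sqnorm !adjmx_col !mul_row_col !adjmx0 !mul0mx add0r addr0.
by rewrite adjmx_scalar -scalar_mxM mxE addrC mxE eqxx mulr1n mulrC.
Qed.

Lemma sqnorm_right_center_col : sqnorm c2 = a * conj a + sqnorm w.
Proof.
rewrite /sqnorm !adjmx_col !mul_row_col !adjmx0 !mul0mx add0r addr0.
by rewrite adjmx_scalar -scalar_mxM mxE mxE eqxx mulr1n mulrC.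
Qed.

Lemma left_center_col_neq0 : b != 0 -> c1 != 0.
Proof.
apply: contra_neq => /eqP; rewrite !col_mx_eq0.
by move=> /andP[_ /andP[/eqP/matrixP/(_ 0 0)]]; rewrite !mxE mulr1n.
Qed.

Lemma right_center_col_neq0 : a != 0 -> c2 != 0.
Proof.
apply: contra_neq => /eqP; rewrite !col_mx_eq0.
by move=> /andP[/andP[/eqP/matrixP/(_ 0 0)]]; rewrite !mxE mulr1n.
Qed.

Let r := a * conj a + sqnorm w.
Let h := b * conj b + sqnorm y.

Definition double_star_core_EP : 'M[F]_((1 + m) + (1 + n)) :=
  block_mx
    (block_mx 0 (h^-1 *: y^h) ((conj a * (b * r)^-1) *: y) 0)
    (block_mx (conj b * h^-1)%:M 0 0 ((b * r)^-1 *: (y *m w^h)))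
    (block_mx (conj a * r^-1)%:M 0 0 ((a * h)^-1 *: (w *m y^h)))
    (block_mx 0 (r^-1 *: w^h) ((conj b * (a * h)^-1) *: w) 0).

(** The block form is the sum of two rank one matrices given by c1 and
    c2, whose block supports are disjoint, so that no two blocks overlap. *)
Lemma double_star_core_EPE : a != 0 -> b != 0 ->
  double_star_core_EP =
    (a * h)^-1 *: (c2 *m c1^h) + (b * r)^-1 *: (c1 *m c2^h).
Proof.
move=> a0 b0; rewrite !adjmx_col !mul_col_row !scale_block_mx !add_block_mx.
rewrite !adjmx0 !adjmx_scalar !mulmx0 !mul0mx !scaler0 !addr0 !add0r.
rewrite !mul_mx_scalar !mul_scalar_mx !scalerA !scale_scalar_mx.
rewrite /double_star_core_EP ![_ * conj _ * _]mulrAC !invfMK //.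
by rewrite ![_^-1 * conj _]mulrC.
Qed.

Lemma double_star_core_EP_spec : a != 0 -> b != 0 ->
    x^T *m y = 0 -> z^T *m w = 0 ->
  (core_EP_invertible conj M <-> r != 0 /\ h != 0) /\
  (r != 0 /\ h != 0 -> is_core_EP_inverse conj M double_star_core_EP).
Proof.
move=> a0 b0 xy zw.
have Mc1 := mul_double_star_left_center xy.
have Mc2 := mul_double_star_right_center zw.
have M2 := double_star_mx_sqr xy zw.
have cEP : r != 0 /\ h != 0 -> is_core_EP_inverse conj M double_star_core_EP.
  rewrite double_star_core_EPE // /r /h.
  rewrite -sqnorm_left_center_col -sqnorm_right_center_col => -[r0 h0].
  exact: (swap_core_EP_inverse a0 b0 Mc1 Mc2 M2 center_cols_orthogonal).
split=> //; split=> [Minv|rh]; last by exists double_star_core_EP; exact: cEP.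
rewrite /r /h -sqnorm_left_center_col -sqnorm_right_center_col.
have c10 := left_center_col_neq0 b0; have c20 := right_center_col_neq0 a0.
exact: (swap_core_EP_invertible_sqnorm a0 b0 Mc1 Mc2 M2 center_cols_orthogonal).
Qed.

End DoubleStar.

(** The adjoint of a double star matrix is a double star matrix, which is why
    the dual statement needs no computation of its own. *)
Lemma adjmx_double_star m n (x y : 'cV[F]_m) (z w : 'cV[F]_n) (a b : F) :
  (double_star_mx x y z w a b)^h =
    double_star_mx (map_mx conj y) (map_mx conj x)
                   (map_mx conj w) (map_mx conj z) (conj b) (conj a).
Proof.
by rewrite /double_star_mx !adjmx_block !adjmx0 !adjmx_scalar !adjmx_tr.
Qed.

End Adjoint.

Unset Implicit Arguments.

Theorem theorem4p1 (F : fieldType) (conj : involutive_rmorphism F)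
    (m n : nat) (hm : (1 <= m)%N) (hn : (1 <= n)%N)
    (x y : 'cV[F]_m) (z w : 'cV[F]_n)
    (hx : forall i, x i 0 != 0) (hy : forall i, y i 0 != 0)
    (hz : forall i, z i 0 != 0) (hw : forall i, w i 0 != 0)
    (a b : F) (ha : a != 0) (hb : b != 0)
    (hxy : x^T *m y = 0) (hzw : z^T *m w = 0) :
  let M := double_star_mx x y z w a b in
  let ys := adjmx conj y in
  let ws := adjmx conj w in
  let xc := map_mx conj x in
  let zc := map_mx conj z in
  let r := a * conj a + (adjmx conj w *m w) 0 0 in
  let h := b * conj b + (adjmx conj y *m y) 0 0 in
  let p := b * conj b + (adjmx conj z *m z) 0 0 in
  let q := a * conj a + (adjmx conj x *m x) 0 0 in
  ((core_EP_invertible conj M <-> r != 0 /\ h != 0) /\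
   (r != 0 /\ h != 0 ->
    is_core_EP_inverse conj M
      (block_mx
        (block_mx 0                                (h^-1 *: ys)
                  ((conj a * (b * r)^-1) *: y)     0)
        (block_mx (conj b * h^-1)%:M               0
                  0                                ((b * r)^-1 *: (y *m ws)))
        (block_mx (conj a * r^-1)%:M               0
                  0                                ((a * h)^-1 *: (w *m ys)))
        (block_mx 0                                (r^-1 *: ws)
                  ((conj b * (a * h)^-1) *: w)     0))))
  /\
  ((dual_core_EP_invertible conj M <-> p != 0 /\ q != 0) /\
   (p != 0 /\ q != 0 ->
    is_dual_core_EP_inverse conj M
      (block_mx
        (block_mx 0                                ((conj b * (a * p)^-1) *: x^T)
                  (q^-1 *: xc)                     0)
        (block_mx (conj b * p^-1)%:M               0
                  0                                ((b * q)^-1 *: (xc *m z^T)))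
        (block_mx (conj a * q^-1)%:M               0
                  0                                ((a * p)^-1 *: (zc *m x^T)))
        (block_mx 0                                ((conj a * (b * q)^-1) *: z^T)
                  (p^-1 *: zc)                     0)))).
Proof.
move=> M ys ws xc zc r h p q.
split; first exact: double_star_core_EP_spec.
have ca0 : conj a != 0 by rewrite fmorph_eq0.
have cb0 : conj b != 0 by rewrite fmorph_eq0.
have conj_orth k (u v : 'cV[F]_k) :
    u^T *m v = 0 -> (map_mx conj v)^T *m map_mx conj u = 0.
  move=> uv; rewrite map_trmx -map_mxM.
  by rewrite -[v^T *m u]trmxK trmx_mul trmxK uv trmx0 map_mx0.
have pE : conj b * conj (conj b) + sqnorm conj zc = p.
  by rewrite sqnorm_map_conj rmorphK mulrC.
have qE : conj a * conj (conj a) + sqnorm conj xc = q.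
  by rewrite sqnorm_map_conj rmorphK mulrC.
have pconj : conj p = p by exact: conj_norm_add_sqnorm.
have qconj : conj q = q by exact: conj_norm_add_sqnorm.
have := double_star_core_EP_spec conj cb0 ca0 (conj_orth _ _ _ hxy)
                                           (conj_orth _ _ _ hzw).
rewrite -adjmx_double_star pE qE => -[inv_iff cEP].
split; first exact: iff_trans (dual_core_EP_invertible_adj _ _) inv_iff.
move=> /cEP/core_EP_inverse_adj; rewrite adjmxK.
rewrite /double_star_core_EP pE qE !adjmx_block.
rewrite !adjmx0 !adjmxZ !adjmxM !adjmx_scalar !adjmxK !adjmx_map.
by rewrite !(conjM, conjV) !rmorphK pconj qconj.
Qed.
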